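(* For every integer $d\ge 1$ there is a constant $C_d>0$, depending only on $d$, such that the following holds. Let $K$ be a field with $\mathrm{char}(K)=0$ or $\mathrm{char}(K)>d$, let $n\ge 1$, and let $f\in K[x_1,\ldots,x_n]_d$ be a form of degree $d$ whose border strength is $\underline{s}(f)=r<\infty$. If $K$ is infinite, then $s_K(f)\le C_d\, r^{d-1}$. If $K$ is finite, then $s_K(f)\le C_d\, r^{d-1}\log(r+1)$.
   Context: $K[x_1,\ldots,x_n]_d$ is the space of homogeneous polynomials (forms) of degree $d$ over $K$ (including $0$). The strength $s_K(f)$ of $f\in K[x_1,\ldots,x_n]_d$ is the minimal number $r\geq 0$ of terms in any expression $f=\sum_{i=1}^r a_ib_i$ where the $a_i,b_i$ are forms in $K[x_1,\ldots,x_n]$ of positive degrees; if $d=1$ and $f\ne 0$, then $s_K(f)=\infty$. Let $\mathcal{P}_d$ be the affine space over $\mathbb{Z}$ with coordinates labelled by the monomials of degree $d$ in $x_1,\ldots,x_n$; its $K$-points are the degree-$d$ forms over $K$. The border strength $\underline{s}(f)$ of $f\in K[x_1,\ldots,x_n]_d$ is the minimal $r\geq 0$ for which there exist $d_1,\ldots,d_r\in\{1,\ldots,d-1\}$ such that $f$ is a $K$-point of the Zariski closure of the image of the morphism (over $\mathbb{Z}$) $$\mu_{d_1,\ldots,d_r}:\prod_{i=1}^r(\mathcal{P}_{d_i}\times\mathcal{P}_{d-d_i})\to\mathcal{P}_d,\quad ((a_1,b_1),\ldots,(a_r,b_r))\mapsto\sum_{i=1}^r a_ib_i.$$ The border strength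 of a nonzero linear form is $\infty$. The logarithm is to base $2$. *)

(* Defs.v *)
From mathcomp Require Import all_boot all_order all_algebra.
From mathcomp Require Import mpoly.

Set Implicit Arguments.
Unset Strict Implicit.
Unset Printing Implicit Defensive.

Import GRing.Theory.
Local Open Scope ring_scope.

(** Strength.  The value oo is represented by the absence of any [s] with
    [strength_is f s].  The zero polynomial is [e.-homog] for every [e]. *)

Definition has_strength_decomp n (K : fieldType) (f : {mpoly K[n]}) (r : nat)
    : Prop :=
  exists a b : 'I_r -> {mpoly K[n]},
    [/\ forall i, exists2 e, (0 < e)%N & a i \is e.-homog,
        forall i, exists2 e, (0 < e)%N & b i \is e.-homog
      & f = \sum_(i < r) a i * b i].

Definition strength_is n (K : fieldType) (f : {mpoly K[n]}) (s : nat) : Prop :=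
  has_strength_decomp f s /\
  forall s', has_strength_decomp f s' -> (s <= s')%N.

(** The affine space P_d over Z: its coordinate ring is the polynomial ring
    over Z whose variables correspond to the monomials of degree d. *)

Definition monomials n d : {set 'X_{1..n < d.+1}} :=
  [set m : 'X_{1..n < d.+1} | mdeg m == d].

Definition coord_ring n d := {mpoly int[#|monomials n d|]}.

Definition coords n d (L : fieldType) (f : {mpoly L[n]})
    : 'I_#|monomials n d| -> L :=
  fun i => f@_(enum_val i : 'X_{1..n < d.+1}).

Definition eval_form n d (L : fieldType) (f : {mpoly L[n]})
    (p : coord_ring n d) : L :=
  mmap intr (coords f) p.

(** The L-point [f] of P_d lies in the closed subset V(S) of Spec Z[P_d]. *)
Definition in_zero_locus n d (S : coord_ring n d -> Prop) (L : fieldType)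
    (f : {mpoly L[n]}) : Prop :=
  forall p, S p -> eval_form f p = 0.

(** Points of a scheme are classes of field-valued points, so a closed subset
    contains the image of a morphism over Z iff it contains the image of every
    L-point of the source, for all fields L of any characteristic.  Here the
    L-points of the source are the families of pairs of forms
    (a_i, b_i) of degrees (e_i, d - e_i). *)
Definition contains_mu_image n d r (e : 'I_r -> nat)
    (S : coord_ring n d -> Prop) : Prop :=
  forall (L : fieldType) (a b : 'I_r -> {mpoly L[n]}),
    (forall i, a i \is (e i).-homog) ->
    (forall i, b i \is (d - e i)%N.-homog) ->
    in_zero_locus S (\sum_(i < r) a i * b i).

(** The Zariski closure is the intersection of all the closed subsets of
    Spec Z[P_d] that contain the image. *)
Definition in_closure_mu n d r (e : 'I_r -> nat) (K : fieldType)
    (f : {mpoly K[n]}) : Prop :=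
  forall S : coord_ring n d -> Prop,
    contains_mu_image e S -> in_zero_locus S f.

Definition has_border_decomp n (d : nat) (K : fieldType) (f : {mpoly K[n]})
    (r : nat) : Prop :=
  exists e : 'I_r -> nat,
    (forall i, (0 < e i < d)%N) /\ in_closure_mu d e f.

(** [f] is meant to be a form of degree [d]; [d] is explicit because it is not
    determined by [f] when [f = 0]. *)
Definition border_strength_is n (d : nat) (K : fieldType) (f : {mpoly K[n]})
    (r : nat) : Prop :=
  has_border_decomp d f r /\
  forall r', has_border_decomp d f r' -> (r <= r')%N.

(* Main.v *)
Require Import Defs.
From HB Require Import structures.
From mathcomp Require Import all_boot all_order all_algebra.
From mathcomp Require Import all_fingroup all_solvable all_field.
From mathcomp Require Import mpoly.
From mathcomp Require Import classical_sets cardinality reals exp.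

(** Write [d = D + 1] and let [F] be the polarization of [f].  For vectors
    [v j i] ([j < D], [i < N]) and [I : [D] -> [N]] consider the covector
    [F(-, v 0 (I 0), ..., v (D-1) (I (D-1)))].  If [f = \sum_(i < r) a_i b_i],
    the Leibniz rule bounds the rank of this family of [N ^ D] covectors by
    [m = 2 r 2 ^ D N ^ (D - 1)]; this is the vanishing of minors which are
    integer polynomials in the coefficients of [f], so it persists when the
    border strength of [f] is [r].  Take [N] of order [r], so that [m < N ^ D].

    Let [k <= m] be the maximal rank of the family, attained at [v] by the
    covectors with indices in [Q], and let [J] lie outside [Q].  Moving the
    vectors [v j (J j)] to [v j (J j) + x], with [x] the tuple of variables, the
    covector with index [J] stays dependent on those in [Q], and Cramer's rule
    gives a relation with polynomial coefficients.  Evaluate this relation at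
    [x] and take its component of degree [d]: the term of index [J] contributes
    [d! f] times a nonzero constant, and everything else is a sum of products of
    forms of positive degrees.  Hence the strength is at most [(k + 1) D], of
    order [r ^ D].

    Polynomials of degree [(k + 1) D] have to be tested at rational points, so a
    finite field must first be enlarged by an extension of degree of order
    [log (r + 1)], which multiplies the strength by at most this degree. *)

Import Order.TTheory GRing.Theory Num.Theory.
Local Open Scope ring_scope.
Local Open Scope classical_set_scope.

Set Implicit Arguments.
Unset Strict Implicit.
Unset Printing Implicit Defensive.

(** * Homogeneous components and degree bounds *)

Lemma mcoeff_pihomog n (A : nzRingType) d (p : {mpoly A[n]}) (m : 'X_{1..n}) :
  (pihomog mdeg d p)@_m = if mdeg m == d then p@_m else 0.
Proof.
rewrite pihomogE raddf_sum /=.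
under eq_bigr do rewrite mcoeffZ mcoeffX.
rewrite big_mkcond /=.
have [mp|mNp] := boolP (m \in msupp p); last first.
  rewrite big1_seq => [|i /andP[_ ip]]; first by case: ifP; rewrite // memN_msupp_eq0.
  case: (eqVneq i m) => [ei|_]; last by rewrite mulr0 if_same.
  by rewrite -ei ip in mNp.
rewrite (bigD1_seq m) ?msupp_uniq //= eqxx mulr1 big1 ?addr0 // => i im.
by rewrite (negPf im) mulr0 if_same.
Qed.

Lemma pihomogM n (A : comNzRingType) d (p q : {mpoly A[n]}) :
  pihomog mdeg d (p * q) =
  \sum_(e < d.+1) pihomog mdeg e p * pihomog mdeg (d - e) q.
Proof.
rewrite [in LHS](mpolyE p) [in RHS](mpolyE p).
under [RHS]eq_bigr do rewrite linear_sum mulr_suml.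
rewrite mulr_suml linear_sum exchange_big /=; apply: eq_bigr => m _.
rewrite [in LHS](mpolyE q) [in RHS](mpolyE q).
under [RHS]eq_bigr do rewrite (linear_sum (pihomog _ _)) mulr_sumr.
rewrite mulr_sumr linear_sum exchange_big /=; apply: eq_bigr => m' _.
under eq_bigr do rewrite !linearZ /= !pihomogX.
rewrite -[in LHS]scalerAl -[in LHS]scalerAr -mpolyXD [in LHS]linearZ /=.
rewrite [in LHS]linearZ /= pihomogX /= mdegD.
case: (eqVneq _ d) => [<-|neq]; last first.
  rewrite !scaler0 big1 // => e _; case: eqP => [ee|_]; last by rewrite scaler0 mul0r.
  case: eqP => [ee'|_]; last by rewrite scaler0 mulr0.
  by move: neq; rewrite ee ee' subnKC ?eqxx // -ltnS.
have lt_e : (mdeg m < (mdeg m + mdeg m').+1)%N by rewrite ltnS leq_addr.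
rewrite (bigD1 (Ordinal lt_e)) //= addKn !eqxx big1 ?addr0 => [|i].
  by rewrite mpolyXD -scalerAl -scalerAr.
by rewrite -val_eqE /= eq_sym => /negPf->; rewrite scaler0 mul0r.
Qed.

Lemma pihomogXM n (A : comNzRingType) d (k : 'I_n) (p : {mpoly A[n]}) :
  pihomog mdeg d.+1 ('X_k * p) = 'X_k * pihomog mdeg d p.
Proof.
rewrite pihomogM (bigD1 (Ordinal (isT : (1 < d.+2)%N))) //= subn1 /=.
rewrite [pihomog _ 1 _]pihomog_dE; last by rewrite dhomogX /= mdeg1.
rewrite big1 ?addr0 // => i.
by rewrite -val_eqE pihomogX /= mdeg1 eq_sym => /negPf->; rewrite mul0r.
Qed.

Lemma pihomog_msize n (A : nzRingType) d (p : {mpoly A[n]}) :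
  (msize p <= d)%N -> pihomog mdeg d p = 0.
Proof.
move=> le_pd; apply/mpolyP => m; rewrite mcoeff_pihomog mcoeff0.
by case: eqP => // md; rewrite memN_msupp_eq0 // msize_mdeg_ge ?md.
Qed.

Lemma pihomog0E n (A : nzRingType) (p : {mpoly A[n]}) :
  pihomog mdeg 0 p = (p@_0)%:MP.
Proof.
apply/mpolyP => m; rewrite mcoeff_pihomog mcoeffC mdeg_eq0.
by case: eqP => [->|]; rewrite ?mulr1 ?mulr0.
Qed.

Lemma dhomog_mcoeff0 n (A : nzRingType) d (p : {mpoly A[n]}) :
  (0 < d)%N -> p \is d.-homog -> p@_0 = 0.
Proof.
by move=> d_gt0 /dhomog_nemf_coeff-> //; rewrite /= mdeg0 eq_sym -lt0n.
Qed.

Lemma dhomog_deriv n (A : nzRingType) d (p : {mpoly A[n]}) (k : 'I_n) :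
  p \is d.+1.-homog -> p^`M(k) \is d.-homog.
Proof.
move=> hp; apply/dhomogP => m; rewrite mcoeff_msupp mcoeff_deriv.
apply: contraNeq => md; rewrite (dhomog_nemf_coeff hp) ?mul0rn //.
by rewrite /= mdegD mdeg1 addn1 eqSS.
Qed.

Lemma dhomog_euler n (A : comNzRingType) d (p : {mpoly A[n]}) :
  p \is d.-homog -> \sum_k 'X_k * p^`M(k) = p *+ d.
Proof.
move=> hp; rewrite {2}(mpolyE p) -sumrMnl.
under eq_bigr => k _.
  rewrite [in p^`M(k)](mpolyE p) linear_sum mulr_sumr; over.
rewrite exchange_big /= !big_seq; apply: eq_bigr => m mp.
rewrite -(dhomog_mf hp mp) /= mdegE -sumrMnr; apply: eq_bigr => k _.
rewrite linearZ /= mderivX -scalerAr scalerMnr; congr (_ *: _).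
rewrite -scalerAr scaler_nat -mpolyXD.
case: (posnP (m k)) => [->//|mk]; congr ('X_[_] *+ _); rewrite addmC submK //.
by apply/mnm_lepP => i; rewrite mnm1E; case: eqP => [<-|].
Qed.

Lemma msizeM_bound n (A : comNzRingType) a b (p q : {mpoly A[n]}) :
  (msize p <= a.+1)%N -> (msize q <= b.+1)%N -> (msize (p * q) <= (a + b).+1)%N.
Proof.
move=> pa qb.
have H m : (a + b < mdeg m)%N -> (p * q)@_m = 0.
  move=> lt_m; rewrite mcoeffM big1 // => -[m1 m2] /= /eqP em.
  have {}lt_m : (a + b < mdeg m1 + mdeg m2)%N by rewrite -mdegD -em.
  have [lt1|le1] := ltnP a (mdeg m1).
    by rewrite [p@_ _]memN_msupp_eq0 ?mul0r // msize_mdeg_ge // (leq_trans pa).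
  rewrite [q@_ _]memN_msupp_eq0 ?mulr0 // msize_mdeg_ge // (leq_trans qb) //.
  by rewrite ltnNge; apply: contraTN lt_m => le2; rewrite -leqNgt leq_add.
rewrite msizeE; apply/bigmax_leqP_seq => m mpq _.
by rewrite ltnS leqNgt; apply: contraTN mpq => /H/eqP; rewrite mcoeff_eq0.
Qed.

Lemma msize_prod n (A : comNzRingType) (I : Type) (s : seq I) (P : pred I) a
    (F : I -> {mpoly A[n]}) :
  (forall i, P i -> (msize (F i) <= a.+1)%N) ->
  (msize (\prod_(i <- s | P i) F i) <= (count P s * a).+1)%N.
Proof.
move=> hF; elim: s => [|i s IH]; first by rewrite big_nil msize1.
rewrite big_cons /=; case: ifP => // Pi.
by rewrite mulnDl mul1n; apply: msizeM_bound; rewrite ?hF.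
Qed.

Lemma msize_det n (A : comNzRingType) k a (M : 'M[{mpoly A[n]}]_k) :
  (forall i j, (msize (M i j) <= a.+1)%N) -> (msize (\det M) <= (k * a).+1)%N.
Proof.
move=> hM; apply: leq_trans (msize_sum _ _ _) _.
apply/bigmax_leqP_seq => s _ _; rewrite -(add0n (k * a)%N); apply: msizeM_bound.
  by rewrite -signr_odd; case: odd; rewrite ?expr0 ?expr1 ?msizeN msize1.
apply: (leq_trans (msize_prod (a := a) _ _)) => [i _ //|].
rewrite ltnS leq_mul2r; apply/orP; right.
by rewrite (leq_trans (count_size _ _)) // /index_enum -enumT size_enum_ord.
Qed.

(** * Polynomials vanishing at rational points, and determinants of low rank *)

Lemma mcoeff_muni n (A : nzRingType) (p : {mpoly A[n.+1]}) (m : 'X_{1..n.+1}) :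
  ((muni p)`_(m ord_max))@_[multinom m (widen_ord (leqnSn n) i) | i < n] = p@_m.
Proof.
rewrite muniE coef_sum raddf_sum /= [in RHS](mpolyE p) raddf_sum /=.
apply: eq_bigr => m' _; rewrite coefZ coefXn mulr_natr mcoeffMn !mcoeffZ !mcoeffX.
rewrite -mulrnAr -mulr_natr -natrM mulnb; congr (_ * (nat_of_bool _)%:R).
apply/andP/eqP => [[/eqP eq_w /eqP eq_max]|->//]; apply/mnmP => i.
have [j ->|->] := unliftP ord_max i; last by rewrite -eq_max.
have -> : lift ord_max j = widen_ord (leqnSn n) j.
  by apply: val_inj; rewrite [LHS]lift_max.
by have /mnmP/(_ j) := eq_w; rewrite !mnmE.
Qed.

(** Induction on [n]: once the other variables are evaluated, [muni p] is a univariate polynomial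
    with more roots in [s] than its degree, so it vanishes, and the induction hypothesis applies to
    each coefficient of [muni p]. *)
Lemma mpoly_eval_eq0 (K : fieldType) (s : seq K) n (p : {mpoly K[n]}) :
  uniq s -> (msize p <= size s)%N -> (forall x, p.@[x] = 0) -> p = 0.
Proof.
move=> us; elim: n p => [|n IH] p szp p0.
  by have := p0 (fun=> 0); rewrite [p]nvar0_mpolyC mevalC => ->; rewrite mpolyC0.
pose w (m : 'X_{1..n.+1}) := [multinom m (widen_ord (leqnSn n) i) | i < n].
have mdegw m : mdeg m = (mdeg (w m) + m ord_max)%N.
  by rewrite !mdegE big_ord_recr; under [in RHS]eq_bigr do rewrite mnmE.
have lt_deg m : m \in msupp p -> (mdeg (w m) + m ord_max < size s)%N.
  by rewrite -mdegw => /msize_mdeg_lt/leq_trans->.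
have eval_muni x y : (map_poly (meval x) (muni p)).[y] = 0.
  rewrite -(p0 (fun i => if unlift ord_max i is Some j then x j else y)).
  rewrite muniE raddf_sum /= horner_sum [in RHS](mpolyE p) raddf_sum /=.
  apply: eq_bigr => m _; rewrite map_polyZ /= map_polyXn hornerZ hornerXn.
  rewrite !mevalZ !mevalX big_ord_recr /= unlift_none mulrA; congr (_ * _ * _).
  apply: eq_bigr => i _; rewrite mnmE.
  have -> : widen_ord (leqnSn n) i = lift ord_max i.
    by apply: val_inj; rewrite [RHS]lift_max.
  by rewrite liftK.
have map0 x : map_poly (meval x) (muni p) = 0.
  apply: (roots_geq_poly_eq0 (rs := s)) => //.
    by apply/allP => y _; rewrite rootE eval_muni.
  rewrite (leq_trans (size_poly _ _)) // muniE.
  apply: (leq_trans (size_sum _ _ _)); apply/bigmax_leqP_seq => m /lt_deg lt_m _.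
  rewrite (leq_trans (size_scale_leq _ _)) // size_polyXn.
  exact: leq_ltn_trans (leq_addl _ _) lt_m.
have muni0 : muni p = 0.
  apply/polyP => i; rewrite coef0; apply: IH => [|x]; last first.
    by rewrite -(coef_map (meval x)) map0 coef0.
  rewrite muniE coef_sum (leq_trans (msize_sum _ _ _)) //.
  apply/bigmax_leqP_seq => m /lt_deg lt_m _; rewrite coefZ coefXn mulr_natr.
  case: (_ == _); rewrite ?mulr0n ?msize0 // mulr1n (leq_trans (msizeZ_le _ _)) //.
  by rewrite msizeX (leq_ltn_trans (leq_addr _ _) lt_m).
by apply/mpolyP => m; rewrite mcoeff0 -mcoeff_muni muni0 coef0 mcoeff0.
Qed.

(** The matrix is a product through [#|T|] columns. Padding both factors with zeros makes them
    square, and the column of index [#|T|] in the first is then zero. *)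
Lemma det_mul_lt (A : comNzRingType) (s : nat) (T : finType)
    (a b : T -> 'I_s -> A) : (#|T| < s)%N ->
  \det (\matrix_(x < s, y < s) \sum_(c : T) a c x * b c y) = 0.
Proof.
move=> ltTs; have [e bij_e] : exists e : 'I_#|T| -> T, bijective e.
  by exists enum_val; apply: enum_val_bij.
pose F (g : T -> 'I_s -> A) (c : 'I_s) x :=
  if insub (val c) is Some c' then g (e c') x else 0.
have -> : (\matrix_(x < s, y < s) \sum_(c : T) a c x * b c y) =
    (\matrix_(x < s, c < s) F a c x) *m (\matrix_(c < s, y < s) F b c y).
  apply/matrixP => x y; rewrite !mxE (reindex e) /=; last exact: onW_bij.
  rewrite [RHS](bigID (fun c : 'I_s => (c < #|T|)%N)) /=.
  rewrite [X in _ = _ + X]big1 => [|c lec]; last by rewrite mxE /F insubN // mul0r.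
  rewrite addr0 (big_ord_narrow (ltnW ltTs)); apply: eq_bigr => c _.
  by rewrite !mxE /F /= valK.
rewrite det_mulmx (expand_det_col _ (Ordinal ltTs)) big1 ?mul0r // => x _.
by rewrite mxE /F /= insubN ?ltnn // mul0r.
Qed.

(** * Directional derivatives and polarization *)

Definition dirder n (A : comNzRingType) (w : 'I_n -> A) (p : {mpoly A[n]}) :=
  \sum_k w k *: p^`M(k).

Definition dirders n (A : comNzRingType) (ws : seq ('I_n -> A)) p :=
  foldr (@dirder n A) p ws.

Lemma dirder_is_linear n (A : comNzRingType) (w : 'I_n -> A) : linear (dirder w).
Proof.
move=> c p q; rewrite /dirder scaler_sumr -big_split; apply: eq_bigr => k _ /=.
by rewrite linearP scalerDr !scalerA mulrC.
Qed.

HB.instance Definition _ n (A : comNzRingType) (w : 'I_n -> A) :=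
  GRing.isLinear.Build A {mpoly A[n]} {mpoly A[n]} _ _ (dirder_is_linear w).

Lemma dirders_is_linear n (A : comNzRingType) (ws : seq ('I_n -> A)) :
  linear (dirders ws).
Proof. by move=> c p q; elim: ws => //= w ws ->; rewrite linearP. Qed.

HB.instance Definition _ n (A : comNzRingType) (ws : seq ('I_n -> A)) :=
  GRing.isLinear.Build A {mpoly A[n]} {mpoly A[n]} _ _ (dirders_is_linear ws).

Lemma dirderM n (A : comNzRingType) (w : 'I_n -> A) p q :
  dirder w (p * q) = dirder w p * q + p * dirder w q.
Proof.
rewrite /dirder mulr_suml mulr_sumr -big_split; apply: eq_bigr => k _ /=.
by rewrite mderivM scalerDr scalerAl scalerAr.
Qed.

Lemma big_tuple_cons (A : nmodType) (T : finType) d (F : seq T -> A) :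
  \sum_(t : d.+1.-tuple T) F t = \sum_(b : T) \sum_(t : d.-tuple T) F (b :: t).
Proof.
rewrite pair_bigA /= (reindex (fun bt : T * d.-tuple T => [tuple of bt.1 :: bt.2])) //.
exists (fun t => (thead t, [tuple of behead t])) => [[b t]|t] _ /=.
  by congr (_, _); apply: val_inj.
by apply: val_inj; rewrite /= [in RHS](tuple_eta t).
Qed.

Lemma dirdersM n (A : comNzRingType) d (ws : seq ('I_n -> A)) p q :
  size ws = d ->
  dirders ws (p * q) =
  \sum_(t : d.-tuple bool)
     dirders (mask t ws) p * dirders (mask (map negb t) ws) q.
Proof.
elim: ws d => [|w ws IH] [|d] //= => [_|[sz]].
  rewrite (eq_bigl (pred1 [tuple])) ?big_pred1_eq // => t.
  exact/esym/eqP/tuple0.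
rewrite (big_tuple_cons d (fun t => dirders (mask t (w :: ws)) p *
   dirders (mask (map negb t) (w :: ws)) q)) big_bool /= (IH _ sz) linear_sum.
by rewrite -big_split; apply: eq_bigr => t _ /=; rewrite dirderM.
Qed.

Lemma map_dirders n (A B : comNzRingType) (h : {rmorphism A -> B})
    (ws : seq ('I_n -> A)) p :
  map_mpoly h (dirders ws p) = dirders [seq h \o w | w <- ws] (map_mpoly h p).
Proof.
elim: ws => //= w ws <-; apply/mpolyP => m.
rewrite mcoeff_map_mpoly /dirder !raddf_sum /=; apply: eq_bigr => k _.
by rewrite !mcoeffZ !mcoeff_deriv mcoeff_map_mpoly rmorphM /= raddfMn.
Qed.

(** For a form of degree [d + 1], this is the coordinate of index [k] of the covector
    [F(-, v 0 (I 0), ...)], with [F] normalized by [F(x, ..., x) = (d + 1)! f]; this normalization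
    keeps all coefficients integral. *)
Definition polar n d N (A : comNzRingType) (v : 'I_d -> 'I_N -> 'I_n -> A)
    (f : {mpoly A[n]}) (k : 'I_n) (I : {ffun 'I_d -> 'I_N}) : A :=
  (dirders [seq v j (I j) | j <- enum 'I_d] f^`M(k))@_0.

Lemma eq_polar n d N (A : comNzRingType) (v w : 'I_d -> 'I_N -> 'I_n -> A) f k I :
  (forall j i k', v j i k' = w j i k') -> polar v f k I = polar w f k I.
Proof.
move=> eq_vw; congr mcoeff; elim: (enum _) => //= j s ->.
by apply: eq_bigr => k' _; rewrite eq_vw.
Qed.

Lemma map_polar n d N (A B : comNzRingType) (h : {rmorphism A -> B})
    (v : 'I_d -> 'I_N -> 'I_n -> A) f k I :
  h (polar v f k I) = polar (fun j i c => h (v j i c)) (map_mpoly h f) k I.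
Proof.
rewrite /polar -mcoeff_map_mpoly map_dirders -map_comp; congr (mcoeff _ (dirders _ _)).
apply/mpolyP => m.
by rewrite mcoeff_map_mpoly !mcoeff_deriv mcoeff_map_mpoly raddfMn.
Qed.

Definition drop_ffun d (T : Type) (j0 : 'I_d.+1) (I : {ffun 'I_d.+1 -> T}) :=
  [ffun j => I (lift j0 j)].

Definition fill_ffun d (T : Type) (x0 : T) (j0 : 'I_d.+1) (J : {ffun 'I_d -> T})
    (j : 'I_d.+1) := if unlift j0 j is Some j' then J j' else x0.

Lemma fill_dropE d (T : Type) (x0 : T) (j0 : 'I_d.+1) I j :
  j != j0 -> fill_ffun x0 j0 (drop_ffun j0 I) j = I j.
Proof.
by rewrite eq_sym => /unlift_some[j' -> ej]; rewrite /fill_ffun liftK ffunE.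
Qed.

(* In each Leibniz term a position is not in the mask [t], since the terms with
   no derivative on [q] vanish; the factor with [p k] only depends on the values
   of [I] at the other positions, which saves one power of [N]. *)
Lemma dirdersM_factor n d N (A : comNzRingType)
    (v : 'I_d.+1 -> 'I_N.+1 -> 'I_n -> A) (p : 'I_n -> {mpoly A[n]}) q :
  q@_0 = 0 ->
  exists (a : d.+1.-tuple bool * {ffun 'I_d -> 'I_N.+1} -> 'I_n -> A)
         (b : d.+1.-tuple bool * {ffun 'I_d -> 'I_N.+1} ->
              {ffun 'I_d.+1 -> 'I_N.+1} -> A),
  forall (k : 'I_n) (I : {ffun 'I_d.+1 -> 'I_N.+1}),
    (dirders [seq v j (I j) | j <- enum 'I_d.+1] (p k * q))@_0 =
    \sum_c a c k * b c I.
Proof.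
(* If [t] is constantly true, [inord] defaults to [0]; this is harmless, since [q] is then not
   differentiated and its constant term is zero. *)
move=> q0; pose pos (t : d.+1.-tuple bool) : 'I_d.+1 := inord (index false t).
pose a (c : d.+1.-tuple bool * {ffun 'I_d -> 'I_N.+1}) k := (dirders (mask c.1
  [seq v j (fill_ffun ord0 (pos c.1) c.2 j) | j <- enum 'I_d.+1]) (p k))@_0.
pose b (c : d.+1.-tuple bool * {ffun 'I_d -> 'I_N.+1}) I :=
  (c.2 == drop_ffun (pos c.1) I)%:R * (dirders (mask
    (map negb c.1) [seq v j (I j) | j <- enum 'I_d.+1]) q)@_0.
exists a, b => k I; rewrite (dirdersM (d := d.+1)); last first.
  by rewrite size_map size_enum_ord.
rewrite raddf_sum -(pair_bigA _ (fun t J => a (t, J) k * b (t, J) I)) /a /b /=.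
apply: eq_bigr => t _; rewrite rmorphM (bigD1 (drop_ffun (pos t) I)) //= eqxx mul1r.
rewrite [X in _ = _ + X]big1 ?addr0 => [|J /negPf->]; last by rewrite mul0r mulr0.
have [t_false|t_true] := boolP (false \in tval t); last first.
  suff -> : map negb t = nseq d.+1 false by rewrite mask_false /= q0 !mulr0.
  apply: (@eq_from_nth _ false) => [|i].
    by rewrite size_map size_tuple size_nseq.
  rewrite size_map => lti; rewrite (nth_map false) // nth_nseq if_same.
  by apply: contraNF t_true => /negbTE<-; apply: mem_nth.
congr (_@_0 * _); congr (dirders _ _).
rewrite -!(map_mask _ t (enum 'I_d.+1)); apply/eq_in_map => j.
rewrite in_mask ?enum_uniq // mem_enum index_enum_ord /= => tj.
rewrite fill_dropE //; apply: contraTneq tj => ->.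
by rewrite inordK -?[X in (_ < X)%N](size_tuple t) ?index_mem // nth_index.
Qed.

(** Differentiating [a_i b_i] once gives two products, each with an undifferentiated factor of zero
    constant term. Applying [dirdersM_factor] to these [2 r] products factors the matrix through
    fewer than [s] columns. *)
Lemma polar_minor_eq0 n d N r s (A : comNzRingType)
    (v : 'I_d.+1 -> 'I_N.+1 -> 'I_n -> A) (a b : 'I_r -> {mpoly A[n]})
    (P : 'I_s -> 'I_n) (Q : 'I_s -> {ffun 'I_d.+1 -> 'I_N.+1}) :
  (forall i, (a i)@_0 = 0) -> (forall i, (b i)@_0 = 0) ->
  (r * 2 * (2 ^ d.+1 * N.+1 ^ d) < s)%N ->
  \det (\matrix_(x, y) polar v (\sum_i a i * b i) (P x) (Q y)) = 0.
Proof.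
move=> a0 b0 lt_s.
pose g (c : 'I_r * bool) := if c.2 then a c.1 else b c.1.
have g0 c : (g c)@_0 = 0 by rewrite /g; case: ifP.
pose Y := {ffun 'I_d.+1 -> 'I_N.+1}.
pose X := (d.+1.-tuple bool * {ffun 'I_d -> 'I_N.+1})%type.
have /fin_all_exists[F FE] : forall c : 'I_r * bool, exists F : (X -> 'I_n -> A) * (X -> Y -> A),
    forall (k : 'I_n) (I : {ffun 'I_d.+1 -> 'I_N.+1}),
    (dirders [seq v j (I j) | j <- enum 'I_d.+1] ((g (c.1, ~~ c.2))^`M(k) * g c))@_0 =
    \sum_t F.1 t k * F.2 t I.
  move=> c; have [F1 [F2 FE]] := dirdersM_factor v (fun k => (g (c.1, ~~ c.2))^`M(k)) (g0 c).
  by exists (F1, F2).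
set M := (M in \det M); have -> : M = \matrix_(x, y) \sum_(ct : ('I_r * bool) * X)
    (F ct.1).1 ct.2 (P x) * (F ct.1).2 ct.2 (Q y).
  apply/matrixP => x y; rewrite !mxE.
  rewrite -(pair_bigA _ (fun c t => (F c).1 t (P x) * (F c).2 t (Q y))) /=.
  under [RHS]eq_bigr do rewrite -FE.
  rewrite /polar (linear_sum (mderiv (P x))) (linear_sum (dirders _)).
  rewrite (raddf_sum (mcoeff _)) /=.
  rewrite -(pair_bigA _ (fun i (c : bool) => (dirders _
    ((g (i, ~~ c))^`M(P x) * g (i, c)))@_0)) /=.
  apply: eq_bigr => i _; rewrite big_bool mderivM linearD mcoeffD /g /=.
  by rewrite addrC [a i * _]mulrC.
by apply: det_mul_lt; rewrite !card_prod card_tuple card_ffun !card_ord card_bool.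
Qed.

(** * From decompositions to border strength *)

Lemma map_mpoly_mpolyC n k (A B : comNzRingType) (h : {rmorphism A -> B})
    (p : {mpoly A[n]}) :
  map_mpoly (map_mpoly h) (map_mpoly (@mpolyC k A) p) =
  map_mpoly (@mpolyC k B) (map_mpoly h p).
Proof.
apply/mpolyP => m; rewrite [LHS]mcoeff_map_mpoly [RHS]mcoeff_map_mpoly /=.
by rewrite (mcoeff_map_mpoly h) (mcoeff_map_mpoly (@mpolyC k A)) map_mpolyC.
Qed.

Lemma map_mpoly_mmap n k (A B : comNzRingType) (h : {rmorphism A -> B})
    (w : 'I_k -> B) (p : {mpoly A[n]}) :
  map_mpoly (mmap h w) (map_mpoly (@mpolyC k A) p) = map_mpoly h p.
Proof.
apply/mpolyP => m; rewrite [LHS]mcoeff_map_mpoly [RHS]mcoeff_map_mpoly /=.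
by rewrite (mcoeff_map_mpoly (@mpolyC k A)) mmapC.
Qed.

(* The form over the coordinate ring of which every form of degree [d] is a
   specialization. *)
Definition generic_form n d : {mpoly (coord_ring n d)[n]} :=
  \sum_(i < #|monomials n d|) 'X_i *: 'X_[enum_val i].

Lemma map_generic_form n d (L : fieldType) (g : {mpoly L[n]}) :
  g \is d.-homog ->
  map_mpoly (mmap intr (coords g) : {rmorphism coord_ring n d -> L})
    (generic_form n d) = g.
Proof.
move=> hg; set h : {rmorphism _ -> _} := mmap _ _.
have sz_g : (msize g <= d.+1)%N.
  by rewrite msizeE; apply/bigmax_leqP_seq => m /(dhomog_mf hg)/= ->.
rewrite [RHS](mpolywE sz_g) (bigID (fun m => m \in monomials n d)) /=.
rewrite [X in _ = _ + X]big1 ?addr0 => [|m]; last first.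
  by rewrite inE => md; rewrite (dhomog_nemf_coeff hg) ?scale0r.
rewrite big_enum_val raddf_sum /=; apply: eq_bigr => i _.
by rewrite map_mpolyZ map_mpolyX /h /= mmapX mmap1U.
Qed.

(** The minor of the generic form at indeterminate vectors has coefficients in [coord_ring]. They
    vanish on the image of the product map by [polar_minor_eq0], hence at [f]; specializing the
    indeterminates then reaches every [v] over [A]. *)
Lemma border_polar_minor_eq0 (K : fieldType) n d N r (e : 'I_r -> nat)
    (f : {mpoly K[n]}) (A : comNzRingType) (h : {rmorphism K -> A}) s
    (v : 'I_d.+1 -> 'I_N.+1 -> 'I_n -> A)
    (P : 'I_s -> 'I_n) (Q : 'I_s -> {ffun 'I_d.+1 -> 'I_N.+1}) :
  f \is d.+2.-homog -> (forall i, 0 < e i < d.+2)%N -> in_closure_mu d.+2 e f ->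
  (r * 2 * (2 ^ d.+1 * N.+1 ^ d) < s)%N ->
  \det (\matrix_(x, y) polar v (map_mpoly h f) (P x) (Q y)) = 0.
Proof.
move=> hf e_lt clos_f lt_s.
pose X := ('I_d.+1 * 'I_N.+1 * 'I_n)%type.
pose gen (B : comNzRingType) (j : 'I_d.+1) (i : 'I_N.+1) (k : 'I_n) :=
  'X_(enum_rank ((j, i, k) : X)) : {mpoly B[#|{: X}|]}.
pose F := map_mpoly (@mpolyC #|{: X}| _) (generic_form n d.+2).
pose minor := \det (\matrix_(x, y) polar (gen _) F (P x) (Q y)).
have map_minor (L : fieldType) (g : {mpoly L[n]}) : g \is d.+2.-homog ->
    map_mpoly (mmap intr (coords g)) minor =
    \det (\matrix_(x, y) polar (gen L) (map_mpoly (@mpolyC _ L) g) (P x) (Q y)).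
  move=> hg; rewrite -det_map_mx; congr (\det _); apply/matrixP => x y.
  rewrite !mxE map_polar.
  have -> : map_mpoly (map_mpoly (mmap intr (coords g))) F = map_mpoly (@mpolyC _ _) g.
    by rewrite map_mpoly_mpolyC map_generic_form.
  by apply: eq_polar => j i k; apply: map_mpolyX.
have minor_f : map_mpoly (mmap intr (coords f)) minor = 0.
  apply/mpolyP => m; rewrite mcoeff_map_mpoly mcoeff0.
  apply: (clos_f (fun p => exists m, p = minor@_m)); last by exists m.
  move=> L a b ha hb _ [m' ->]; rewrite /eval_form -mcoeff_map_mpoly.
  rewrite map_minor; last first.
    apply: rpred_sum => i _; have /andP[_ /ltnW le_e] := e_lt i.
    by rewrite -(subnKC le_e); apply: dhomogM.
  have -> : map_mpoly (@mpolyC #|{: X}| L) (\sum_i a i * b i) =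
      \sum_i map_mpoly (@mpolyC _ L) (a i) * map_mpoly (@mpolyC _ L) (b i).
    rewrite (rmorph_sum (map_mpoly (@mpolyC #|{: X}| L))).
    by apply: eq_bigr => i _; apply: rmorphM.
  rewrite polar_minor_eq0 ?mcoeff0 // => i; rewrite mcoeff_map_mpoly.
    by rewrite (dhomog_mcoeff0 _ (ha i)) ?mpolyC0 //; case/andP: (e_lt i).
  by rewrite (dhomog_mcoeff0 _ (hb i)) ?mpolyC0 // subn_gt0; case/andP: (e_lt i).
move: minor_f; rewrite map_minor // => /(congr1 (mmap h (fun t =>
  let: (j, i, k) := enum_val t in v j i k))).
rewrite raddf0 -det_map_mx => <-; congr (\det _); apply/matrixP => x y.
rewrite !mxE map_polar map_mpoly_mmap.
apply: eq_polar => j i k; apply/esym/(etrans (mmapX _ _ _)).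
by rewrite mmap1U enum_rankK.
Qed.

(** * Moving vectors by the tuple of variables *)

Lemma map_mpoly_deriv n (A B : comNzRingType) (h : {rmorphism A -> B})
    (p : {mpoly A[n]}) k :
  map_mpoly h p^`M(k) = (map_mpoly h p)^`M(k).
Proof.
by apply/mpolyP => m; rewrite mcoeff_map_mpoly !mcoeff_deriv mcoeff_map_mpoly raddfMn.
Qed.

Definition shift_vec n (A : comNzRingType) (c : 'I_n -> A) (e : A) (k : 'I_n) :
  {mpoly A[n]} := (c k)%:MP + e *: 'X_k.

Definition varX n (A : comNzRingType) (k : 'I_n) : {mpoly A[n]} := 'X_k.
Arguments varX {n A}.

Lemma dirders_nseqS n (A : comNzRingType) e (w : 'I_n -> A) p :
  dirders (nseq e.+1 w) p = dirders (nseq e w) (dirder w p).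
Proof. by elim: e => //= e ->. Qed.

(** Derivatives act on the outer variables, while the entries of [varX] are the inner ones. Each
    derivation is an instance of Euler's formula, and the successive degrees multiply to [e!]. *)
Lemma dirders_varX n (A : comNzRingType) e (g : {mpoly A[n]}) :
  g \is e.-homog ->
  (dirders (nseq e varX) (map_mpoly (@mpolyC n A) g))@_0 = g *+ e`!.
Proof.
elim: e g => [|e IH] g hg.
  rewrite /= mcoeff_map_mpoly mulr1n -[RHS](pihomog_dE hg).
  by rewrite pihomog0E.
rewrite dirders_nseqS /dirder linear_sum raddf_sum /=.
under eq_bigr => k _.
  rewrite linearZ mcoeffZ -map_mpoly_deriv IH ?dhomog_deriv // mulrnAr; over.
by rewrite sumrMnl (dhomog_euler hg) -mulrnA factS.
Qed.

Lemma msizeMn_le n (A : nzRingType) (p : {mpoly A[n]}) k : (msize (p *+ k) <= msize p)%N.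
Proof. by rewrite -scaler_nat msizeZ_le. Qed.

Lemma mcoeff_dirder n (A : comNzRingType) (w : 'I_n -> A) p m :
  (dirder w p)@_m = \sum_k w k * (p@_(m + U_(k)) *+ (m k).+1).
Proof.
rewrite /dirder (raddf_sum (mcoeff m)); apply: eq_bigr => k _.
by rewrite [LHS]mcoeffZ mcoeff_deriv.
Qed.

(** Each vector is affine in the variables and the derivatives are multilinear in the vectors, so
    the top component only sees the linear parts. *)
Lemma dirders_shift_vec n (A : comNzRingType) (l : seq (('I_n -> A) * A))
    (g : {mpoly A[n]}) m :
  let y := (dirders [seq shift_vec t.1 t.2 | t <- l] (map_mpoly (@mpolyC n A) g))@_m in
  (msize y <= (size l).+1)%N /\
  pihomog mdeg (size l) y =
  (\prod_(t <- l) t.2) *: (dirders (nseq (size l) varX) (map_mpoly (@mpolyC n A) g))@_m.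
Proof.
elim: l m => [|t l IH] m /=.
  rewrite mcoeff_map_mpoly /= msizeC leq_b1; split=> //.
  by rewrite pihomog0E mcoeffC eqxx mulr1 big_nil scale1r.
move: (dirders _ _) (dirders (nseq _ _) _) IH => D E IH.
split.
  rewrite mcoeff_dirder (leq_trans (msize_sum _ _ _)) //; apply/bigmax_leqP_seq => k _ _.
  apply: (@msizeM_bound _ _ 1 (size l)); last first.
    by have [sz_y _] := IH (m + U_(k))%MM; apply: leq_trans (msizeMn_le _ _) sz_y.
  rewrite /shift_vec (leq_trans (msizeD_le _ _)) // geq_max msizeC.
  by rewrite (leq_trans (leq_b1 _)) // (leq_trans (msizeZ_le _ _)) // msizeX mdeg1.
rewrite [in LHS]mcoeff_dirder [in RHS]mcoeff_dirder.
rewrite (linear_sum (pihomog _ _)) scaler_sumr.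
apply: eq_bigr => k _; have [] := IH (m + U_(k))%MM.
move: (D@__) (E@__) => Y Z sz_y top_y.
rewrite /shift_vec mulrDl linearD /=.
rewrite mul_mpolyC -scalerAl !linearZ /= pihomogXM !linearMn /= top_y.
rewrite (pihomog_msize sz_y) scaler0 mul0rn add0r big_cons -scalerA.
by rewrite scalerMnr -scalerAr.
Qed.

(** * From vanishing minors to a strength decomposition *)

Lemma strength_decomp_fin n (K : fieldType) (T : finType) (a b : T -> {mpoly K[n]}) :
  (forall t, exists2 e, (0 < e)%N & a t \is e.-homog) ->
  (forall t, exists2 e, (0 < e)%N & b t \is e.-homog) ->
  has_strength_decomp (\sum_t a t * b t) #|T|.
Proof.
move=> ha hb; exists (fun i => a (enum_val i)), (fun i => b (enum_val i)); split=> //.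
by rewrite (reindex (@enum_val T T)) //=; apply: onW_bij; apply: enum_val_bij.
Qed.

(** Take the component of degree [d + 1] of the relation. The part of degree [0] of [H j] is zero;
    its part of degree [d + 1] meets a constant, and gives a nonzero multiple of [f] for [j = ord0]
    and zero otherwise. For each [j], there remain [d] products of forms of positive degrees. *)
Lemma strength_of_syzygy n (K : fieldType) d k (f : {mpoly K[n]})
    (H G : 'I_k.+1 -> {mpoly K[n]}) (c : K) :
  c != 0 -> (G ord0)@_0 != 0 -> (forall j, (H j)@_0 = 0) ->
  (forall j, pihomog mdeg d.+1 (H j) = (j == ord0)%:R *: (c *: f)) ->
  \sum_j H j * G j = 0 -> has_strength_decomp f (k.+1 * d).
Proof.
move=> c0 G0 H0 Htop /(congr1 (pihomog mdeg d.+1)).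
rewrite linear_sum pihomog0 /=.
pose u := - (c * (G ord0)@_0)^-1.
have -> : (k.+1 * d)%N = #|{: 'I_k.+1 * 'I_d}| by rewrite card_prod !card_ord.
under eq_bigr => j _.
  rewrite pihomogM big_ord_recl pihomog0E H0 mpolyC0 mul0r add0r big_ord_recr /=.
  rewrite subnn pihomog0E Htop; over.
rewrite big_split /= [X in _ + X](bigD1 ord0) //= [X in _ + (_ + X)]big1; last first.
  by move=> j /negPf->; rewrite scale0r mul0r.
rewrite addr0 scale1r [X in _ + X]mulrC mul_mpolyC scalerA => /eqP.
rewrite addr_eq0 -scaleNr => /eqP sum_eq.
have -> : f = \sum_(t : 'I_k.+1 * 'I_d) u *: pihomog mdeg t.2.+1 (H t.1) *
     pihomog mdeg (d - t.2) (G t.1).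
  rewrite -(pair_bigA _ (fun j (e : 'I_d) => u *: pihomog mdeg e.+1 (H j) *
     pihomog mdeg (d - e) (G j))) /=.
  under eq_bigr do under eq_bigr do rewrite -scalerAl.
  under eq_bigr do rewrite -scaler_sumr.
  rewrite -scaler_sumr sum_eq scalerA /u mulrNN mulrC [_ * c]mulrC divff ?scale1r //.
  by rewrite mulf_neq0.
apply: (@strength_decomp_fin n K ('I_k.+1 * 'I_d)%type
  (fun t => u *: pihomog mdeg t.2.+1 (H t.1))
  (fun t => pihomog mdeg (d - t.2) (G t.1))) => -[j e] /=.
  by exists e.+1 => //; apply: rpredZ; apply: pihomogP.
by exists (d - e)%N; rewrite ?subn_gt0 //; apply: pihomogP.
Qed.

(** If [I] differs from [J], one of its vectors is not moved, so the degree in the variables drops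
    below [d]. *)
Lemma polar_shift_vec n d N (K : comNzRingType) (v : 'I_d -> 'I_N -> 'I_n -> K)
    (J : {ffun 'I_d -> 'I_N}) (f : {mpoly K[n]}) k I :
  f \is d.+1.-homog ->
  let y := polar (fun j i => shift_vec (v j i) (i == J j)%:R)
             (map_mpoly (@mpolyC n K) f) k I in
  (msize y <= d.+1)%N /\
  pihomog mdeg d y = (I == J)%:R *: (f^`M(k) *+ d`!).
Proof.
move=> hf /=; rewrite /polar -map_mpoly_deriv.
pose l := [seq (v j (I j), ((I j == J j)%:R : K)) | j <- enum 'I_d].
have := dirders_shift_vec l f^`M(k) 0.
rewrite /= -map_comp big_map size_map size_enum_ord dirders_varX ?dhomog_deriv //.
suff -> : \prod_(j <- enum 'I_d) ((v j (I j), ((I j == J j)%:R : K)).2) =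
  (I == J)%:R by [].
rewrite big_enum /=; have [->|neqIJ] := eqVneq I J.
  by rewrite big1 // => j _; rewrite eqxx.
have [j neqj] : exists j, I j != J j.
  apply/existsP; rewrite -negb_forall; apply: contra neqIJ => /forallP eqIJ.
  by apply/eqP/ffunP => j; apply/eqP.
by rewrite (bigD1 j) //= (negPf neqj) mul0r.
Qed.

Lemma map_mpolyK n (A B : comNzRingType) (h : {rmorphism A -> B})
    (h' : {rmorphism B -> A}) (p : {mpoly A[n]}) :
  cancel h h' -> map_mpoly h' (map_mpoly h p) = p.
Proof.
move=> hK; apply/mpolyP => m.
by rewrite [LHS]mcoeff_map_mpoly /= (mcoeff_map_mpoly h) hK.
Qed.

Lemma eval_polar_shift_vec n d N (K : comNzRingType)
    (v : 'I_d -> 'I_N -> 'I_n -> K) (J : {ffun 'I_d -> 'I_N}) (f : {mpoly K[n]}) k I x :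
  (polar (fun j i => shift_vec (v j i) (i == J j)%:R)
     (map_mpoly (@mpolyC n K) f) k I).@[x] =
  polar (fun j i k => v j i k + (i == J j)%:R * x k) f k I.
Proof.
rewrite map_polar (map_mpolyK f (mevalC x)); apply: eq_polar => j i k'.
by rewrite /= /shift_vec mevalD mevalC mevalZ mevalXU.
Qed.

Lemma mcoeff0_polar_shift_vec n d N (K : comNzRingType)
    (v : 'I_d -> 'I_N -> 'I_n -> K) (J : {ffun 'I_d -> 'I_N}) (f : {mpoly K[n]}) k I :
  (polar (fun j i => shift_vec (v j i) (i == J j)%:R)
     (map_mpoly (@mpolyC n K) f) k I)@_0 =
  polar v f k I.
Proof.
rewrite map_polar (map_mpolyK f (@mpolyCK n K)); apply: eq_polar => j i k'.
by rewrite /= mcoeffD mcoeffC eqxx mulr1 mcoeffZ mcoeffX mnm1_eq0 mulr0 addr0.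
Qed.

Lemma ex_first_failure (P : nat -> Prop) m :
  ~ P 0%N -> P m -> exists k, (k < m)%N /\ ~ P k /\ P k.+1.
Proof.
elim: m => [//|m IH] P0 Pm; case: (boolp.EM (P m)) => Pm'.
  by have [k [lt_k Pk]] := IH P0 Pm'; exists k; split=> //; apply: ltnW.
by exists m.
Qed.

(** The size of [s] is set by determinants of size at most [m] with entries of degree at most [d].
    The bound [m <= N ^ d] leaves an index outside any minor of size less than [m]. *)
Lemma strength_le_minors (K : fieldType) n d N m (f : {mpoly K[n]})
    (s : seq K) :
  f \is d.+1.-homog -> (d.+1)`!%:R != 0 :> K ->
  (m <= N ^ d)%N -> uniq s -> (m * d < size s)%N ->
  (forall (v : 'I_d -> 'I_N -> 'I_n -> K) (P : 'I_m -> 'I_n) Q,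
     \det (\matrix_(x, y) polar v f (P x) (Q y)) = 0) ->
  exists2 k, (k <= m)%N & has_strength_decomp f (k * d).
Proof.
move=> hf df lt_m us lt_s minor0.
pose minors0 k := forall (v : 'I_d -> 'I_N -> 'I_n -> K) (P : 'I_k -> 'I_n)
  (Q : 'I_k -> {ffun 'I_d -> 'I_N}),
  \det (\matrix_(x, y) polar v f (P x) (Q y)) = 0.
(* Such a [k] exists since the empty determinant is [1]. It is the maximal rank over all [v] at
   once, so it still bounds the rank after the vectors are moved. *)
have [||k [lt_km [nPk Pk]]] := @ex_first_failure minors0 m; last 1 first.
- have [v [P [Q nz]]] : exists v P (Q : 'I_k -> {ffun 'I_d -> 'I_N}),
      \det (\matrix_(x, y) polar v f (P x) (Q y)) != 0.
    apply: boolp.contrapT => no; apply: nPk => v P Q.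
    by apply/eqP/negPn/negP => nz; apply: no; exists v, P, Q.
  have [J _ nQ] : exists2 J, J \in {: {ffun 'I_d -> 'I_N}} & J \notin codom Q.
    apply/subsetPn; apply: contraL lt_km => /subset_leq_card le_card.
    rewrite -leqNgt (leq_trans lt_m) //.
    rewrite -[X in (_ <= X)%N]card_ord -[X in (X ^ _)%N]card_ord.
    rewrite -[X in (_ ^ X)%N]card_ord -card_ffun (leq_trans le_card) //.
    exact: leq_image_card.
  exists k.+1 => //.
  pose vx j i := shift_vec (v j i) (i == J j)%:R.
  pose G := polar vx (map_mpoly (@mpolyC n K) f).
  pose q (j : 'I_k.+1) := if unlift ord0 j is Some j' then Q j' else J.
  have qJ j : (q j == J) = (j == ord0).
    rewrite /q; have [j' ->|->] := unliftP ord0 j; last by rewrite !eqxx.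
    rewrite (eq_sym _ ord0) (negPf (neq_lift _ _)).
    by apply: contraNF nQ => /eqP<-; apply: codom_f.
  (* Cofactors along the first row of the bordered matrix; the constant term of [C ord0] is the
     nonzero minor at [v]. *)
  pose C (j : 'I_k.+1) := (-1) ^+ ((ord0 : 'I_k.+1) + j) *
     \det (\matrix_(x < k, y < k) G (P x) (q (lift j y))).
  have syzG k0 : \sum_j G k0 (q j) * C j = 0.
    pose p (j : 'I_k.+1) := if unlift ord0 j is Some j' then P j' else k0.
    pose M := \matrix_(x, y) G (p x) (q y).
    transitivity (\det M).
      rewrite (expand_det_row _ ord0); apply: eq_bigr => j _.
      rewrite mxE /p unlift_none; congr (_ * (_ * \det _)).
      by apply/matrixP => x y; rewrite !mxE /p liftK.
    (* At a rational point [x], this determinant is a minor of size [k + 1] for the vectors moved by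
       [x], hence zero. *)
    apply: (mpoly_eval_eq0 us) => [|x].
      apply: leq_trans (msize_det (a := d) _) _ => [i j|].
        by rewrite mxE; case: (polar_shift_vec v J (p i) (q j) hf).
      by apply: leq_ltn_trans lt_s; rewrite leq_mul2r lt_km orbT.
    rewrite -(det_map_mx (meval x)).
    rewrite -[RHS](Pk (fun j i k => v j i k + (i == J j)%:R * x k) p q).
    congr (\det _); apply/matrixP => i j; rewrite !mxE.
    exact: eval_polar_shift_vec.
  (* Contracting the covectors with the variables turns the top component into [(d + 1)! f] for the
     index [J], by Euler's formula. *)
  apply: (@strength_of_syzygy n K d k f (fun j => \sum_k0 'X_k0 * G k0 (q j)) C
     (d.+1)`!%:R) => // [|j|j|].
  + rewrite /C expr0 mul1r -(det_map_mx (mcoeff 0)); congr (\det _ != 0): nz.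
    apply/matrixP => x y; rewrite !mxE /q liftK.
    exact/esym/mcoeff0_polar_shift_vec.
  + rewrite raddf_sum big1 //= => k0 _.
    by rewrite (rmorphM (mcoeff 0)) /= mcoeffX mnm1_eq0 mul0r.
  + rewrite linear_sum /=; under eq_bigr => k0 _.
      rewrite pihomogXM (polar_shift_vec v J k0 (q j) hf).2 qJ -scalerAr.
      rewrite mulrnAr; over.
    rewrite -scaler_sumr sumrMnl (dhomog_euler hf) -mulrnA factS.
    by rewrite [in RHS]scaler_nat [in RHS]scaler_nat scaler_nat.
  + under eq_bigr do rewrite mulr_suml.
    rewrite exchange_big big1 //= => k0 _; under eq_bigr do rewrite -mulrA.
    by rewrite -mulr_sumr syzG mulr0.
- have e0 T : 'I_0 -> T by case.
  move/(_ (fun _ _ _ => 0) (e0 _) (e0 _))/eqP.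
  by rewrite det_mx00 oner_eq0.
- exact: minor0.
Qed.

(** * Change of base field *)

Lemma dhomog_map n (A B : nzRingType) (h : {additive A -> B}) d (p : {mpoly A[n]}) :
  p \is d.-homog -> map_mpoly h p \is d.-homog.
Proof.
move=> hp; apply/dhomogP => m; rewrite mcoeff_msupp mcoeff_map_mpoly.
by apply: contraNeq => md; rewrite (dhomog_nemf_coeff hp) ?raddf0.
Qed.

(** Expanding each [a i] in a basis of [L] splits [a i * b i] into [\dim {: L}] products with first
    factor over [F]. A coordinate functional that does not kill [1] brings the second factor down to
    [F] and multiplies [f] by a nonzero constant. *)
Lemma strength_restrict_scalars n (F : fieldType) (L : fieldExtType F)
    (f : {mpoly F[n]}) s :
  has_strength_decomp (map_mpoly (in_alg L) f) s ->
  has_strength_decomp f (s * \dim {: L}).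
Proof.
move=> [a [b [ha hb fE]]]; pose B := vbasis {: L}.
have BE x : x = \sum_j coord B j x *: B`_j by apply: coord_vbasis; apply: memvf.
have [j0 c0] : exists j, coord B j 1 != 0.
  apply/existsP; apply: contraT; rewrite negb_exists => /forallP B1.
  have := oner_neq0 L; rewrite (BE 1) big1 ?eqxx // => j _.
  by have := B1 j; rewrite negbK => /eqP->; rewrite scale0r.
set c := coord B j0 1 in c0.
have mulE (p q : {mpoly L[n]}) : map_mpoly (coord B j0) (p * q) =
    \sum_j map_mpoly (coord B j) p * map_mpoly (coord B j0) (B`_j *: q).
  apply/mpolyP => m; rewrite mcoeff_map_mpoly raddf_sum /=.
  under [RHS]eq_bigr do rewrite mcoeffM.
  rewrite exchange_big mcoeffM raddf_sum /=; apply: eq_bigr => k _.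
  rewrite [in LHS](BE p@_(k.1)) mulr_suml linear_sum; apply: eq_bigr => j _.
  by rewrite !mcoeff_map_mpoly mcoeffZ -scalerAl linearZ.
have -> : f = \sum_(t : 'I_s * 'I_(\dim {: L}))
    c^-1 *: map_mpoly (coord B t.2) (a t.1) * map_mpoly (coord B j0) (B`_t.2 *: b t.1).
  rewrite -(pair_bigA _ (fun i j => c^-1 *: map_mpoly (coord B j) (a i) *
    map_mpoly (coord B j0) (B`_j *: b i))) /=.
  under eq_bigr => i _.
    under eq_bigr do rewrite -scalerAl.
    rewrite -scaler_sumr -mulE; over.
  rewrite -scaler_sumr -(raddf_sum (map_mpoly (coord B j0))) -fE.
  apply/mpolyP => m; rewrite mcoeffZ !mcoeff_map_mpoly /= linearZ /= -/c.
  by rewrite mulrCA mulVf ?mulr1.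
have -> : (s * \dim {: L})%N = #|{: 'I_s * 'I_(\dim {: L})}| by rewrite card_prod !card_ord.
apply: (@strength_decomp_fin n F ('I_s * 'I_(\dim {: L}))%type
  (fun t => c^-1 *: map_mpoly (coord B t.2) (a t.1))
  (fun t => map_mpoly (coord B j0) (B`_t.2 *: b t.1))) => -[i j] /=.
  have [e e0 hai] := ha i; exists e => //.
  by apply: rpredZ; apply: dhomog_map.
have [e e0 hbi] := hb i; exists e => //.
by apply: dhomog_map; apply: rpredZ.
Qed.

(* The splitting field of [X^(#|F|^k) - X], as in the proof of
   [pPrimePowerField], which only covers prime fields. *)
Lemma finField_extension (F : finFieldType) k : (0 < k)%N ->
  exists L : fieldExtType F, (\dim {: L} <= k)%N /\
    exists2 s : seq L, uniq s & size s = (#|F| ^ k)%N.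
Proof.
move=> k_gt0; set m := (#|F| ^ k)%N.
have m_gt1 : (m > 1)%N by rewrite (ltn_exp2l 0) ?finNzRing_gt1.
have m_gt0 := ltnW m_gt1; have m1_gt0 : (m.-1 > 0)%N by rewrite -ltnS prednK.
pose q (A : nzRingType) : {poly A} := 'X^m - 'X.
have Dq A : q A = ('X^(m.-1) - 1) * ('X - 0).
  by rewrite subr0 mulrBl mul1r -exprSr prednK.
have /FinSplittingFieldFor[/= L splitLq] : q F != 0.
  by rewrite Dq monic_neq0 ?rpredM ?monicXsubC ?monicXnsubC.
rewrite [map_poly _ (q F)]rmorphB rmorphXn /= map_polyX -/(q L) in splitLq.
have m0 : m%:R = 0 :> L.
  have F0 : #|F|%:R = 0 :> F by rewrite -cardsT -FinRing.Theory.zmodXgE expg_cardG ?inE.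
  by rewrite natrX -(rmorph_nat (in_alg L)) F0 rmorph0 expr0n gtn_eqF.
have /finField_galois_generator[/= a _ Da] : (1 <= {:L})%VS by apply: sub1v.
pose Em := fixedSpace (a ^+ k)%g; rewrite dimv1 expn1 in Da.
have {splitLq} [zs DqL defL] := splitLq.
have Uzs : uniq zs.
  rewrite -separable_prod_XsubC -(eqp_separable DqL) Dq separable_root andbC.
  rewrite /root !hornerE subr_eq0 eq_sym expr0n gtn_eqF ?oner_eq0 //=.
  rewrite cyclotomic.separable_Xn_sub_1 // -subn1 natrB // subr_eq0.
  by rewrite m0 eq_sym oner_eq0.
have sz_zs : size zs = m.
  apply: succn_inj; rewrite -(size_prod_XsubC _ id).
  by rewrite -(eqp_size DqL) size_polyDl size_polyXn // size_polyN size_polyX.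
(* The roots are the fixed points of the [k]-th power of the Frobenius [a]; they form a subfield,
   hence all of [L]. *)
have in_zs : zs =i Em.
  move=> z; rewrite -root_prod_XsubC -(eqp_root DqL) (sameP fixedSpaceP eqP).
  rewrite /root !hornerE subr_eq0 /= /m; congr (_ == z).
  elim: (k) => [|i IHi]; first by rewrite gal_id.
  by rewrite expgSr expnSr exprM IHi galM ?Da ?memvf.
have defEm : Em = {:L}%VS.
  apply/eqP; rewrite eqEsubv subvf -defL -[Em]subfield_closed agenvS //.
  by rewrite subv_add sub1v; apply/span_subvP=> z; rewrite in_zs.
exists L; split; last by exists zs.
(* The dimension is bounded by counting: [L] has only [m] elements. *)
rewrite -(leq_exp2l _ _ (finNzRing_gt1 F)) -/m -sz_zs.
pose B := vbasis {: L}; pose g (c : {ffun 'I_(\dim {: L}) -> F}) := \sum_i c i *: B`_i.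
have g_inj : injective g.
  move=> c c' eq_g; apply/ffunP => i; have freeB := basis_free (vbasisP {: L}).
  by rewrite -(coord_sum_free c i freeB) -(coord_sum_free c' i freeB) -/(g c) eq_g.
rewrite -[X in (_ ^ X <= _)%N]card_ord -card_ffun cardE -(size_map g).
apply: uniq_leq_size; first by rewrite map_inj_uniq ?enum_uniq.
by move=> x _; rewrite in_zs defEm memvf.
Qed.

(** An equality of fields, rather than an isomorphism, lets all that concerns [K] be transported by
    substitution. *)
Lemma finField_of_finite_set (K : fieldType) : finite_set [set: K] ->
  exists F : finFieldType, F = K :> fieldType.
Proof.
case/finite_seqP => s0 s0E; pose s := undup s0.
have in_s x : x \in s.
  by rewrite mem_undup; have : [set` s0] x by rewrite -s0E.
have sK : pcancel (fun x => index x s)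
    (fun i => if (i < size s)%N then Some (nth 0 s i) else None).
  by move=> x; rewrite index_mem in_s nth_index.
have fin : Finite.axiom s by move=> x; rewrite count_uniq_mem ?undup_uniq // in_s.
exists (HB.pack_for finFieldType K (Choice_isCountable.Build K sK)
  (isFinite.Build K fin)).
(* Both structures only agree once [K] is given by its explicit mixins. *)
by move: {s0E in_s} (s) sK fin; case: K {s s0} => T [].
Qed.

Lemma infinite_set_uniq_seq (T : choiceType) k : infinite_set [set: T] ->
  exists2 s : seq T, uniq s & (k <= size s)%N.
Proof.
move=> /(infinite_set_fset k)[B _ le_k].
by exists (finmap.enum_fset B); rewrite ?finmap.fset_uniq.
Qed.

(** * Explicit bounds and conclusion *)

Lemma strength_is_le n (K : fieldType) (f : {mpoly K[n]}) k :
  has_strength_decomp f k -> exists2 s, (s <= k)%N & strength_is f s.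
Proof.
move=> fk; have exP : exists i, boolp.asbool (has_strength_decomp f i).
  by exists k; apply/boolp.asboolP.
case: (ex_minnP exP) => s /boolp.asboolP fs min_s.
exists s; first by apply: min_s; apply/boolp.asboolP.
by split=> // s' /boolp.asboolP/min_s.
Qed.

Lemma fact_neq0 (K : fieldType) d :
  [pchar K] =i pred0 \/ (exists2 p, p \in [pchar K] & (d < p)%N) ->
  d`!%:R != 0 :> K.
Proof.
case=> [/pcharf0P->|[p pcharK lt_dp]]; first by rewrite -lt0n fact_gt0.
rewrite fact_prod natr_prod prodf_seq_neq0; apply/allP => i /=.
rewrite mem_index_iota ltnS => /andP[i_gt0 le_id].
rewrite -(dvdn_pcharf pcharK); apply: contraL lt_dp => /dvdn_leq le_pi.
by rewrite -leqNgt (leq_trans (le_pi i_gt0)).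
Qed.

(** The empty sum has the origin as its only value, and the coordinate functions cut out the
    origin. *)
Lemma closure_mu0 n d (K : fieldType) (e : 'I_0 -> nat) (f : {mpoly K[n]}) :
  f \is d.-homog -> in_closure_mu d e f -> f = 0.
Proof.
move=> hf clos_f; rewrite -(map_generic_form hf) raddf_sum big1 //= => i _.
rewrite map_mpolyZ /= [X in X *: _](_ : _ = 0) ?scale0r //.
apply: (clos_f (fun p => exists j, p = 'X_j)); last by exists i.
move=> L a b _ _ _ [j ->].
by rewrite /eval_form mmapX mmap1U big_ord0 /coords mcoeff0.
Qed.

Lemma expSn_bound N d : (N * N.+1 ^ d < N.+1 ^ d.+1)%N.
Proof. by rewrite expnS ltn_pmul2r // expn_gt0. Qed.

Lemma strength_border_bound (K L : fieldType) (h : {rmorphism K -> L}) n d r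
    (e : 'I_r -> nat) (f : {mpoly K[n]}) (s : seq L) :
  (0 < r)%N -> uniq s -> ((r * 2 ^ d.+3) ^ d.+1 * d.+1 < size s)%N ->
  f \is d.+2.-homog -> (d.+2)`!%:R != 0 :> K ->
  (forall i, 0 < e i < d.+2)%N -> in_closure_mu d.+2 e f ->
  exists2 k, (k <= (r * 2 ^ d.+3) ^ d.+1 * d.+1)%N &
    has_strength_decomp (map_mpoly h f) k.
Proof.
move=> r0 us lt_s hf df he clos_f.
(* With [N + 1] vectors in each position, the rank bound [N (N + 1)^d] is less than the number
   [(N + 1)^(d + 1)] of covectors. The constant [2 ^ d.+3] comes from [N + 1 <= 2 N]. *)
pose N := (r * 2 * 2 ^ d.+1)%N; pose m := (N * N.+1 ^ d).+1.
have le_m : (m <= N.+1 ^ d.+1)%N by apply: expSn_bound.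
have le_N : (N.+1 <= r * 2 ^ d.+3)%N.
  rewrite (expnS 2 d.+2) mulnA [X in (_ <= X)%N](_ : _ = N * 2)%N.
    by rewrite muln2 -addnn -addn1 leq_add2l /N !muln_gt0 r0 expn_gt0.
  by rewrite /N -[RHS]mulnA -expnSr.
have le_md : (m * d.+1 <= (r * 2 ^ d.+3) ^ d.+1 * d.+1)%N.
  by rewrite leq_mul2r (leq_trans le_m) ?leq_exp2r.
have [|||||v P Q|k le_k hk] := @strength_le_minors L n d.+1 N.+1 m (map_mpoly h f) s.
- exact: dhomog_map.
- by rewrite -(rmorph_nat h) fmorph_eq0.
- exact: le_m.
- exact: us.
- exact: leq_ltn_trans le_md lt_s.
- apply: (border_polar_minor_eq0 h v P Q hf he clos_f).
  by rewrite /m mulnA.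
- by exists (k * d.+1)%N => //; rewrite (leq_trans _ le_md) // leq_mul2r le_k orbT.
Qed.

Lemma log2_ge (R : realType) r k : (2 ^ k <= r.+1)%N ->
  k%:R <= ln (r%:R + 1) / ln 2 :> R.
Proof.
move=> le_k; have ln2 : 0 < ln 2 :> R by rewrite ln_gt0 // ltr1n.
rewrite ler_pdivlMr // mulr_natl -lnXn // -natrX natr1.
by rewrite ler_ln ?posrE ?ltr0n ?expn_gt0 // ler_nat.
Qed.

(** Rounding up costs at most [1], which is at most the logarithm of [r + 1] since [r > 0]. *)
Lemma up_log_le (R : realType) r : (0 < r)%N ->
  (up_log 2 r.+1)%:R <= 2 * (ln (r%:R + 1) / ln 2) :> R.
Proof.
move=> r0; have t_gt0 : (0 < up_log 2 r.+1)%N by rewrite up_log_gt0.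
rewrite -(prednK t_gt0) -addn1 natrD mulrDl mul1r lerD //.
  by apply/log2_ge/ltnW/up_log_gtn.
by apply: (@log2_ge _ _ 1).
Qed.

Theorem theorem1p6 (R : realType) (d : nat) (hd : (0 < d)%N) :
  exists C : R, 0 < C /\
    forall (K : fieldType),
      ([pchar K] =i pred0 \/ exists2 p : nat, p \in [pchar K] & (d < p)%N) ->
    forall (n : nat), (0 < n)%N ->
    forall (f : {mpoly K[n]}) (r : nat),
      f \is d.-homog ->
      border_strength_is d f r ->
      exists s : nat, strength_is f s /\
        (infinite_set [set: K] ->
           s%:R <= C * r%:R ^+ (d - 1)) /\
        (finite_set [set: K] ->
           s%:R <= C * r%:R ^+ (d - 1) * (ln (r%:R + 1) / ln 2)).
Proof.
case: d hd => // d _; rewrite subn1 /=.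
(* [C0] collects the factors of [strength_border_bound] free of [r], [d * (d + 5)] bounds the degree
   of the field extension relative to the logarithm, and [+ 1] keeps [C] positive in degree one. *)
pose C0 := ((2 ^ d.+2) ^ d * d)%N; pose C := (C0 * (d * (d + 5)) + 1)%N.
exists C%:R; split=> [|K /fact_neq0 df n _ f r hf [[e [e_lt clos_f]] _]].
  by rewrite ltr0n /C addn1.
case: r => [|r] in e e_lt clos_f *.
  have -> : f = 0 by apply: closure_mu0 hf clos_f.
  exists 0%N; split; last first.
    split=> _; first by rewrite mulr_ge0 ?exprn_ge0 ?ler0n.
    by rewrite add0r ln1 mul0r mulr0.
  split=> //; exists (fun=> 0), (fun=> 0).
  by split=> [[]|[]|] //; rewrite big_ord0.
(* In degree one, no [e] satisfies [0 < e < 1], so [r] cannot be positive. *)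
case: d => [|d] in C0 C df hf e_lt clos_f *.
  by have := e_lt ord0; case: (e ord0) => [|[]].
pose b := ((r.+1 * 2 ^ d.+3) ^ d.+1 * d.+1)%N.
have bE : b = (C0 * r.+1 ^ d.+1)%N by rewrite /b /C0 expnMn -mulnA mulnC.
have [Kfin|Kinf] := boolp.pselect (finite_set [set: K]).
  (* In [k], the part [(t + d + 3)(d + 1)] accounts for the power in [b], and the remaining [d + 1]
     for the factor [d + 1 < 2^(d + 1)]. Every field has at least two elements, so [2 ^ k] bounds
     the number of test points from below. *)
  pose t := up_log 2 r.+2; pose k := (d.+1 * t + d.+1 * (d + 4))%N.
  have lt_b : (b < 2 ^ k)%N.
    have le_t : (r.+1 <= 2 ^ t)%N by apply: ltnW; apply: up_logP.
    have -> : k = ((t + d.+3) * d.+1 + d.+1)%N.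
      by rewrite /k -mulnDr mulnC [RHS]addnC -mulSn !addnS addn0.
    rewrite expnD; apply: leq_ltn_trans (_ : _ <= 2 ^ ((t + d.+3) * d.+1) * d.+1)%N _.
      by rewrite leq_mul2r expnM leq_exp2r // expnD leq_mul2r le_t !orbT.
    by rewrite ltn_pmul2l ?expn_gt0 // ltn_expl.
  have k0 : (0 < k)%N by rewrite /k addn_gt0 muln_gt0 addnS orbT.
  have [F eF] := finField_of_finite_set Kfin.
  case: K / eF in df f hf clos_f Kfin *.
  have [L [dimL [s us sz_s]]] := finField_extension F k0.
  have [||j le_j hj] :=
    @strength_border_bound F L (in_alg L) n d r.+1 e f s _ us _ hf df e_lt clos_f.
  - by [].
  - by rewrite sz_s (leq_trans lt_b) // leq_exp2r // finNzRing_gt1.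
  have [s' le_s' hs'] := strength_is_le (strength_restrict_scalars hj).
  exists s'; split=> //; split=> [/(_ Kfin)//|_].
  have le_s : (s' <= C0 * r.+1 ^ d.+1 * k)%N.
    by rewrite (leq_trans le_s') // leq_mul // -bE.
  pose x : R := ln (r.+1%:R + 1) / ln 2.
  have x1 : 1 <= x by apply: (@log2_ge _ _ 1).
  (* This combines [t <= 2 x] with [1 <= x]. *)
  have le_k : k%:R <= (d.+1 * (d.+1 + 5))%:R * x.
    have -> : (d.+1 + 5)%N = (2 + (d + 4))%N by rewrite !addnS !addn0.
    rewrite /k -mulnDr !natrM -mulrA ler_wpM2l ?ler0n //.
    rewrite [X in X <= _]natrD (natrD _ 2 (d + 4)) mulrDl.
    by apply: lerD; [apply: up_log_le|rewrite ler_peMr ?ler0n].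
  rewrite -/x (@le_trans _ _ (C0 * r.+1 ^ d.+1 * k)%:R) ?ler_nat //.
  rewrite 2!natrM natrX (@le_trans _ _ (C0%:R * r.+1%:R ^+ d.+1 *
    ((d.+1 * (d.+1 + 5))%:R * x))) ?ler_wpM2l ?mulr_ge0 ?exprn_ge0 ?ler0n //.
  rewrite mulrA ler_wpM2r ?(le_trans ler01) // mulrAC -natrM ler_wpM2r ?exprn_ge0 ?ler0n //.
  by rewrite ler_nat leq_addr.
have [s us le_s] := infinite_set_uniq_seq b.+1 Kinf.
have [||j le_j hj] :=
  @strength_border_bound K K idfun n d r.+1 e f s _ us _ hf df e_lt clos_f => //.
have hj' : has_strength_decomp f j.
  suff <- : map_mpoly idfun f = f by [].
  by apply/mpolyP => m; rewrite (mcoeff_map_mpoly idfun).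
have [s' le_s' hs'] := strength_is_le hj'.
exists s'; split=> //; split=> // _.
rewrite -natrX -natrM ler_nat (leq_trans le_s') // (leq_trans le_j) // -/b bE leq_mul //.
by rewrite /C addn1 (leq_trans _ (leqnSn _)) // leq_pmulr.
Qed.
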